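(* Let $C$ be a coalgebra over a field $K$ such that $C\cong \mathrm{Rat}(C^*_{C^*})$ as right $C^*$-modules (equivalently, as left $C$-comodules). Then $C$ is left semiperfect and $C\cong\mathrm{Rat}({}_{C^*}C^* )$ as left $C^*$-modules.
   Context: $C^*$ is the dual algebra with convolution. $C$ is a right $C^*$-module via $c\cdot c^*=c^*(c_1)c_2$ and a left $C^*$-module via $c^*\cdot c=c_1c^*(c_2)$. ${}_{C^*}C^*$ and $C^*_{C^*}$ denote $C^*$ as left, resp. right, regular module. For a left (resp. right) $C^*$-module $N$, $\mathrm{Rat}(N)$ is the largest submodule whose action arises from a right (resp. left) $C$-comodule structure, via $c^*\cdot n=n_0c^*(n_1)$ (resp. $n\cdot c^*=c^*(n_{-1})n_0$). $C$ is left semiperfect if every finite dimensional left $C$-comodule has a projective cover; equivalently, the injective envelope of every simple right $C$-comodule is finite dimensional. *)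

(* Defs.v *)
(* Coalgebras, comodules and rational parts of the dual
   algebra, encoded without a tensor-product library: an element of a tensor
   product U (x) V is represented by a finite sequence of pairs, and two such
   representations are identified through their pairings with functionals
   (over a field these pairings separate points of U (x) V, U (x) V (x) W,
   M (x) C, ...). *)
From HB Require Import structures.
From mathcomp Require Import all_boot all_algebra.
Set Implicit Arguments. Unset Strict Implicit. Unset Printing Implicit Defensive.
Import GRing.Theory.
Local Open Scope ring_scope.

Section Coalg.
Variable K : fieldType.

Definition co_functional (V : lmodType K) (f : V -> K) : Prop :=
  forall (a : K) (u v : V), f (a *: u + v) = a * f u + f v.
Definition co_linmap (U V : lmodType K) (f : U -> V) : Prop :=
  forall (a : K) (u v : U), f (a *: u + v) = a *: f u + f v.

(* pairing of the tensor  sum_p p.1 (x) p.2  with  f (x) g *)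
Definition tpair (U V : Type) (t : seq (U * V)) (f : U -> K) (g : V -> K) : K :=
  \sum_(p <- t) f p.1 * g p.2.

(* A coalgebra (C, Delta, eps); Delta c = sum_p p.1 (x) p.2 = c_1 (x) c_2 *)
Record coalgebra := Coalgebra {
  ccar :> lmodType K;
  comul : ccar -> seq (ccar * ccar);
  counit : ccar -> K;
  counit_functional : co_functional counit;
  comul_linear : forall f g, co_functional f -> co_functional g ->
    co_functional (fun c => tpair (comul c) f g);
  comul_coassoc : forall (f g h : ccar -> K) (c : ccar),
    co_functional f -> co_functional g -> co_functional h ->
    \sum_(p <- comul c) tpair (comul p.1) f g * h p.2 =
    \sum_(p <- comul c) f p.1 * tpair (comul p.2) g h;
  counit_l : forall c, \sum_(p <- comul c) counit p.1 *: p.2 = c;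
  counit_r : forall c, \sum_(p <- comul c) counit p.2 *: p.1 = c
}.

Section Comod.
Variable C : coalgebra.

Definition dual_elt (f : C -> K) := co_functional f.
Definition conv (f g : C -> K) : C -> K := fun c => tpair (comul c) f g.
Definition ract (c : C) (f : C -> K) : C := \sum_(p <- comul c) f p.1 *: p.2.
Definition lact (f : C -> K) (c : C) : C := \sum_(p <- comul c) f p.2 *: p.1.

(* Right C-comodules  rho m = sum_p p.1 (x) p.2 = m_0 (x) m_1 *)
Record rcomod := RComod {
  rcar : lmodType K;
  rcoact : rcar -> seq (rcar * C);
  rc_linear : forall h, co_functional h ->
    co_linmap (fun m => \sum_(p <- rcoact m) h p.2 *: p.1);
  rc_coassoc : forall (f g : C -> K) m, co_functional f -> co_functional g ->
    \sum_(p <- rcoact m) \sum_(q <- rcoact p.1) (f q.2 * g p.2) *: q.1 =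
    \sum_(p <- rcoact m) tpair (comul p.2) f g *: p.1;
  rc_counit : forall m, \sum_(p <- rcoact m) counit p.2 *: p.1 = m
}.

(* Left C-comodules  rho m = sum_p p.1 (x) p.2 = m_{-1} (x) m_0 *)
Record lcomod := LComod {
  lcar : lmodType K;
  lcoact : lcar -> seq (C * lcar);
  lc_linear : forall h, co_functional h ->
    co_linmap (fun m => \sum_(p <- lcoact m) h p.1 *: p.2);
  lc_coassoc : forall (f g : C -> K) m, co_functional f -> co_functional g ->
    \sum_(p <- lcoact m) tpair (comul p.1) f g *: p.2 =
    \sum_(p <- lcoact m) \sum_(q <- lcoact p.2) (f p.1 * g q.1) *: q.2;
  lc_counit : forall m, \sum_(p <- lcoact m) counit p.1 *: p.2 = m
}.

Definition dual_linmap (U : lmodType K) (i : U -> (C -> K)) : Prop :=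
  (forall u, dual_elt (i u)) /\
  (forall (a : K) (u v : U), i (a *: u + v) =1 (fun c => a * i u c + i v c)).
Definition dual_inj (U : Type) (i : U -> (C -> K)) : Prop :=
  forall u v, i u =1 i v -> u = v.

(* Rat(C^*_{C^* }): union of the submodules of the right regular module C^*
   (action f . h = f * h) whose action comes from a left C-comodule
   structure, n . c^* = c^*(n_{-1}) n_0; such a submodule is presented as the
   image of an injective linear map i : M -> C^* transporting the structure. *)
Definition Rat_right_reg (f : C -> K) : Prop :=
  exists (M : lcomod) (i : lcar M -> (C -> K)),
    [/\ dual_linmap i, dual_inj i,
        (forall m h, dual_elt h ->
           conv (i m) h =1 (fun c => \sum_(p <- lcoact m) h p.1 * i p.2 c))
      & exists m, i m =1 f].

(* Rat({}_{C^* }C^* ): same for the left regular module (action h . f = h * f),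
   with a right C-comodule structure, c^* . n = n_0 c^*(n_1). *)
Definition Rat_left_reg (f : C -> K) : Prop :=
  exists (M : rcomod) (i : rcar M -> (C -> K)),
    [/\ dual_linmap i, dual_inj i,
        (forall m h, dual_elt h ->
           conv h (i m) =1 (fun c => \sum_(p <- rcoact m) h p.2 * i p.1 c))
      & exists m, i m =1 f].

Definition iso_Rat_right : Prop :=
  exists phi : C -> (C -> K),
    [/\ dual_linmap phi, dual_inj phi,
        (forall c, Rat_right_reg (phi c)),
        (forall f, Rat_right_reg f -> exists c, phi c =1 f)
      & (forall c h, dual_elt h -> phi (ract c h) =1 conv (phi c) h)].

Definition iso_Rat_left : Prop :=
  exists phi : C -> (C -> K),
    [/\ dual_linmap phi, dual_inj phi,
        (forall c, Rat_left_reg (phi c)),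
        (forall f, Rat_left_reg f -> exists c, phi c =1 f)
      & (forall c h, dual_elt h -> phi (lact h c) =1 conv h (phi c))].

Definition rc_hom (M N : rcomod) (f : rcar M -> rcar N) : Prop :=
  co_linmap f /\
  forall h m, co_functional h ->
    f (\sum_(p <- rcoact m) h p.2 *: p.1) = \sum_(p <- rcoact (f m)) h p.2 *: p.1.

Definition rc_nonzero (M : rcomod) : Prop := exists m : rcar M, m <> 0.

(* subcomodules presented as monomorphisms (injective comodule maps) *)
Definition rc_simple (S : rcomod) : Prop :=
  rc_nonzero S /\
  forall (A : rcomod) (i : rcar A -> rcar S), rc_hom i -> injective i ->
    ~ rc_nonzero A \/ (forall s, exists a, i a = s).

Definition rc_injective (E : rcomod) : Prop :=
  forall (A B : rcomod) (i : rcar A -> rcar B) (f : rcar A -> rcar E),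
    rc_hom i -> injective i -> rc_hom f ->
    exists g : rcar B -> rcar E, rc_hom g /\ forall a, g (i a) = f a.

Definition rc_essential (S E : rcomod) (i : rcar S -> rcar E) : Prop :=
  forall (A : rcomod) (j : rcar A -> rcar E), rc_hom j -> injective j ->
    rc_nonzero A -> exists a s, j a <> 0 /\ j a = i s.

Definition rc_injective_envelope (S E : rcomod) (i : rcar S -> rcar E) : Prop :=
  [/\ rc_hom i, injective i, rc_injective E & rc_essential i].

Definition finite_dim (V : lmodType K) : Prop :=
  exists (n : nat) (e : 'I_n -> V),
    forall v, exists a : 'I_n -> K, v = \sum_(k < n) a k *: e k.

Definition left_semiperfect : Prop :=
  forall S : rcomod, rc_simple S ->
    exists (E : rcomod) (i : rcar S -> rcar E),
      rc_injective_envelope i /\ finite_dim (rcar E).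

End Comod.
End Coalg.

(* Main.v *)
Require Import Defs.
From HB Require Import structures.
From mathcomp Require Import all_boot all_algebra boolp classical_sets.
(* Write [phi : C -> C^*] for the given isomorphism and [B(c, d) = phi c d].
   Then [B(c . h, d) = B(c, h . d)] and [B] is nondegenerate on the left.
   For [e = B(-, d)] one has [B(c . e, x) = sum B(x, d_1) B(c, d_2)], so
   [c |-> c . e] has finite rank; such functionals [e] separate the points of
   [C] and lie in the right rational part, i.e. in the image of [phi].  Hence
   [B] is nondegenerate on the right too, and [psi d = B(-, d)] is the required
   isomorphism onto the left rational part: if [f] is left rational, then
   [c . f], hence [f c = eps (c . f)], vanishes on the common kernel of finitely
   many [psi d_i], so [f] is a combination of these.

   For a simple right comodule [S] inside [C], some functional [a] fixing [S]
   acts with finite rank on [C]; when this rank is minimal, [C . a] is the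
   injective envelope of [S].  Essentiality: if [A] in [C . a] meets [S]
   trivially, extend [eps] on [S] and [0] on [A] to [b]; then [a * b] fixes [S]
   and has smaller rank unless [A = 0].  Injectivity: by minimality [a] acts
   injectively on the finite dimensional [C . a], hence bijectively, and
   inverting it exhibits [C . a] as a retract of [C]. *)
Set Implicit Arguments. Unset Strict Implicit. Unset Printing Implicit Defensive.
Import GRing.Theory.
Local Open Scope ring_scope.

(** * Linear maps, functionals and their extension *)

Section Linear.
Variable K : fieldType.

Lemma colin0 (U V : lmodType K) (f : U -> V) : co_linmap f -> f 0 = 0.
Proof. by move/(_ (-1) 0 0); rewrite !scaleN1r !addNr. Qed.

Lemma colinZ (U V : lmodType K) (f : U -> V) (a : K) (u : U) :
  co_linmap f -> f (a *: u) = a *: f u.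
Proof. by move=> lf; rewrite -[a *: u]addr0 lf (colin0 lf) addr0. Qed.

Lemma colinB (U V : lmodType K) (f : U -> V) :
  co_linmap f -> {morph f : u v / u - v}.
Proof. by move=> lf u v; rewrite addrC -scaleN1r lf scaleN1r addrC. Qed.

Lemma colin_sum (U V : lmodType K) (f : U -> V) (I : Type) (s : seq I)
    (a : I -> K) (x : I -> U) :
  co_linmap f -> f (\sum_(i <- s) a i *: x i) = \sum_(i <- s) a i *: f (x i).
Proof.
move=> lf; elim: s => [|i s IH]; first by rewrite !big_nil colin0.
by rewrite !big_cons lf IH.
Qed.

Lemma colin_ker_inj (U V : lmodType K) (f : U -> V) :
  co_linmap f -> (forall u, f u = 0 -> u = 0) -> injective f.
Proof.
move=> lf kf u v e; apply/eqP; rewrite -subr_eq0; apply/eqP/kf.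
by rewrite colinB // e subrr.
Qed.

Lemma cofun_lin (U : lmodType K) (f : U -> K) :
  co_functional f -> @co_linmap K U K^o f.
Proof. by []. Qed.

Lemma cofun0 (U : lmodType K) (f : U -> K) : co_functional f -> f 0 = 0.
Proof. by move/cofun_lin/colin0. Qed.

Lemma cofunB (U : lmodType K) (f : U -> K) :
  co_functional f -> {morph f : u v / u - v}.
Proof. by move/cofun_lin/colinB. Qed.

Lemma cofunZ (U : lmodType K) (f : U -> K) (a : K) (u : U) :
  co_functional f -> f (a *: u) = a * f u.
Proof. by move/cofun_lin/colinZ. Qed.

Lemma cofun_sum (U : lmodType K) (f : U -> K) (I : Type) (s : seq I)
    (a : I -> K) (x : I -> U) :
  co_functional f -> f (\sum_(i <- s) a i *: x i) = \sum_(i <- s) a i * f (x i).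
Proof. by move/cofun_lin=> lf; rewrite (colin_sum _ _ _ lf). Qed.

Lemma cofun_comb (U : lmodType K) (k : K) (f g : U -> K) :
  co_functional f -> co_functional g -> co_functional (fun u => k * f u + g u).
Proof.
move=> lf lg a u v; rewrite lf lg !mulrDr !mulrA (mulrC k a) addrACA.
by congr (_ + _).
Qed.

(* Zorn's lemma is applied to the linear relations [G] between [V] and [W]
   that are compatible with [f] along [i]; compatibility makes [G] univalent. *)
Lemma linear_extension (U V W : lmodType K) (i : U -> V) (f : U -> W) :
  co_linmap i -> co_linmap f -> (forall u, i u = 0 -> f u = 0) ->
  exists2 g : V -> W, co_linmap g & forall u, g (i u) = f u.
Proof.
move=> li lf kif.
pose P (G : set (V * W)) :=
  (forall (a : K) x y, G x -> G y -> G (a *: x + y)) /\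
  (forall u w, G (i u, w) -> w = f u).
have [] := @Zorn_bigcup _ P.
  move=> F FP Ft; split=> [a x y [X FX Xx] [Y FY Yy]|u w [X FX Xw]].
    have [XY|YX] := Ft _ _ FX FY.
      by exists Y => //; apply: (FP _ FY).1 => //; apply: XY.
    by exists X => //; apply: (FP _ FX).1 => //; apply: YX.
  exact: (FP _ FX).2 Xw.
move=> G [[Gc Gf] Gmax].
have Gmax' B : (forall x, G x -> B x) -> P B -> forall x, B x -> G x.
  move=> GB PB x Bx; apply: contrapT => nGx; apply: (Gmax B) => //.
  by split=> // BG; exact: nGx (BG _ Bx).
(* The empty relation satisfies [P], so membership of 0 has to come from maximality: without 0, [G]
   would be empty and could be enlarged to the zero relation. *)
have G0 : G 0.
  apply: contrapT => nG0; apply: (nG0); apply: (Gmax' [set 0]%classic) => //.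
    by move=> x Gx; case: nG0; rewrite -(addNr x) -scaleN1r; apply: Gc.
  by split=> [a x y -> ->|u w [/kif -> ->]]; rewrite ?scaler0 ?addr0.
have GZ a x : G x -> G (a *: x) by move=> Gx; rewrite -[_ *: _]addr0; apply: Gc.
have GB x y : G x -> G y -> G (x - y).
  by move=> Gx Gy; rewrite addrC -scaleN1r; apply: Gc.
(* By maximality, [G] already contains every pair [(v, w)] whose span can be added to [G] without
   breaking compatibility with [f]. *)
have Gadd v w : (forall b x y u, G (x, y) -> x + b *: v = i u ->
    y + b *: w = f u) -> G (v, w).
  move=> H.
  apply: (Gmax' (fun z => exists b, G (z - b *: (v, w)))) => [x Gx||].
  - by exists 0; rewrite scale0r subr0.
  - split=> [a x y [b Gx] [c Gy]|u z [b Gb]].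
      exists (a * b + c); rewrite scalerDl -scalerA opprD addrACA -scalerBr.
      exact: Gc.
    have /= := H b (i u - b *: v) (z - b *: w) u Gb.
    by rewrite !subrK; apply.
  - by exists 1; rewrite scale1r subrr.
have Gi u : G (i u, f u).
  apply: Gadd => b x y u' Gx e; have ex : x = i (u' - b *: u).
    by rewrite (colinB li) (colinZ _ _ li) -e addrK.
  rewrite ex in Gx; rewrite (Gf _ _ Gx) (colinB lf) (colinZ _ _ lf).
  by rewrite subrK.
have Gtot v : exists w, G (v, w).
  (* If [v] is outside the domain of [G], even [(v, 0)] can be adjoined, since a relation
     [x + b *: v = i u] with [b] nonzero would put [v] in the domain. *)
  apply: contrapT => nv; apply: (nv); exists 0; apply: Gadd => b x y u Gx e.
  have [b0|bn0] := eqVneq b 0.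
    by move: e Gx; rewrite b0 scaler0 scale0r !addr0 => -> /Gf.
  case: nv; exists (b^-1 *: (f u - y)).
  have -> : v = b^-1 *: (i u - x).
    by rewrite -e addrAC subrr add0r scalerA mulVf // scale1r.
  exact: (GZ b^-1 (i u - x, f u - y) (GB _ _ (Gi u) Gx)).
have [g Gg] := choice Gtot.
have Gu v w w' : G (v, w) -> G (v, w') -> w = w'.
  move=> G1 G2; apply/eqP; rewrite -subr_eq0; apply/eqP; rewrite -(colin0 lf).
  apply: Gf; have := GB _ _ G1 G2; rewrite /GRing.add /= /add_pair /=.
  by rewrite subrr (colin0 li).
exists g => [a u v|u]; last exact: Gu (Gg _) (Gi _).
apply: Gu (Gg _) _; exact: (Gc a (u, g u) (v, g v)).
Qed.
End Linear.

(** * Linear subspaces as vector spaces of their own *)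

Section Subspace.
Variables (K : fieldType) (V : lmodType K) (P : V -> Prop).
Hypotheses (P0 : P 0) (PD : forall (a : K) u v, P u -> P v -> P (a *: u + v)).

Let Pb : {pred V} := fun v => `[< P v >].

Let Pb_closed : submod_closed Pb.
Proof.
split; first exact/asboolP.
by move=> a u v /asboolP Pu /asboolP Pv; apply/asboolP/PD.
Qed.

HB.instance Definition _ := GRing.isSubmodClosed.Build K V Pb Pb_closed.

Let subsp := {v : V | Pb v}.
HB.instance Definition _ := SubChoice.on subsp.
HB.instance Definition _ := [SubChoice_isSubLmodule of subsp by <:].

Lemma subspace_lmod : exists (A : lmodType K) (j : A -> V),
  [/\ co_linmap j, injective j & forall v, P v <-> exists a, j a = v].
Proof.
exists (subsp : lmodType K), val; split=> [a u v| |v]; first by [].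
  exact: val_inj.
split=> [Pv|[a <-]]; last exact/asboolP/(valP a).
have Pbv : Pb v by apply/asboolP.
by exists (Sub v Pbv : subsp); rewrite SubK.
Qed.

End Subspace.

(** * Maps of finite rank and minimal families of functionals *)

Section FiniteRank.
Variables (K : fieldType) (V W : lmodType K) (L : V -> W).
Variable X : (V -> K) -> Prop.
Hypothesis linL : co_linmap L.
Hypothesis linX : forall f, X f -> co_functional f.
Hypothesis XD : forall (a : K) f g, X f -> X g -> X (fun v => a * f v + g v).

(** When [X] holds all functionals this says that [L] has rank at most [n]; a smaller [X] records
    which functionals [L] factors through. Stating it with kernels avoids bases of the image. *)
Definition fin_rank (n : nat) : Prop := exists2 g : 'I_n -> V -> K,
  forall j, X (g j) & forall v, (forall j, g j v = 0) -> L v = 0.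

(** Gaussian elimination: subtracting multiples of [g j] makes the other functionals vanish at [v].
    A common zero of these differs from a common zero of all [g k] by a multiple of [v], which [L]
    kills. *)
Lemma fin_rank_drop n (g : 'I_n.+1 -> V -> K) (j : 'I_n.+1) (v : V) :
  (forall k, X (g k)) -> (forall w, (forall k, g k w = 0) -> L w = 0) ->
  L v = 0 -> g j v != 0 -> fin_rank n.
Proof.
move=> Xg kg Lv gv.
exists (fun k w => - (g (lift j k) v / g j v) * g j w + g (lift j k) w).
  by move=> k; apply: XD.
move=> w gw; pose b := g j w / g j v.
suff : L (w - b *: v) = 0
  by rewrite (colinB linL) (colinZ _ _ linL) Lv scaler0 subr0.
apply: kg => k; rewrite (cofunB (linX (Xg k))) (cofunZ _ _ (linX (Xg k))).
case: (unliftP j k) => [k' ->|->]; last by rewrite /b divfK ?subrr.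
by rewrite -(gw k') /b addrC mulNr; congr (- _ + _); rewrite mulrC mulrA mulrAC.
Qed.

(** Both parts use minimality. A [g k] nonzero somewhere on the kernel of [L] would allow an
    elimination; and if no vector is dual to [g k], then [g k] vanishes wherever the others do and
    can be discarded. *)
Lemma fin_rank_minimal n (g : 'I_n -> V -> K) :
  (forall k, X (g k)) -> (forall v, (forall k, g k v = 0) -> L v = 0) ->
  (forall m, (m < n)%N -> ~ fin_rank m) ->
  (forall v, L v = 0 -> forall k, g k v = 0) /\
  exists z : 'I_n -> V, forall j k, g j (z k) = (j == k)%:R.
Proof.
move=> Xg kg nmin.
have Lg v : L v = 0 -> forall k, g k v = 0.
  move=> Lv k; apply/eqP/negP => /negP gv.
  case: n g Xg kg nmin k gv => [|n] g Xg kg nmin k gv; first by case: k gv.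
  by apply: (nmin n); rewrite ?ltnSn //; apply: (fin_rank_drop Xg kg Lv gv).
split=> //.
suff /choice [z gz] : forall k, exists z, forall j, g j z = (j == k)%:R.
  by exists z.
case: n g Xg kg nmin Lg => [|n] g Xg kg nmin Lg; first by case.
move=> k; apply: contrapT => nz; apply: (nmin n); rewrite ?ltnSn //.
exists (fun j => g (lift k j)) => // v gv; apply: kg => j.
case: (unliftP k j) => [j' ->|->]; first exact: gv.
apply/eqP/negP => /negP gkv; case: nz; exists ((g k v)^-1 *: v) => i.
rewrite (cofunZ _ _ (linX (Xg i))).
case: (unliftP k i) => [i' ->|->]; last by rewrite mulVf ?eqxx.
by rewrite gv mulr0 eq_sym (negbTE (neq_lift _ _)).
Qed.

Lemma fin_rank_least n : fin_rank n ->
  exists2 m, fin_rank m & forall k, (k < m)%N -> ~ fin_rank k.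
Proof.
move=> rn; have ex : exists n, `[< fin_rank n >] by exists n; apply/asboolP.
case: (ex_minnP ex) => m /asboolP rm mmin; exists m => // k km /asboolP /mmin.
by rewrite leqNgt km.
Qed.

(** The vector [v - \sum_k g k v *: z k] is a common zero of the [g k], so [F] kills it. *)
Lemma dual_expansion (W' : lmodType K) (F : V -> W') n (g : 'I_n -> V -> K)
    (z : 'I_n -> V) :
  co_linmap F -> (forall k, co_functional (g k)) ->
  (forall j k, g j (z k) = (j == k)%:R) ->
  (forall v, (forall k, g k v = 0) -> F v = 0) ->
  forall v, F v = \sum_k g k v *: F (z k).
Proof.
move=> lF lg gz kF v; rewrite -(colin_sum _ _ _ lF).
apply/eqP; rewrite -subr_eq0 -(colinB lF); apply/eqP/kF => k.
rewrite (cofunB (lg k)) (cofun_sum _ _ _ (lg k)) (bigD1 k) //= gz eqxx mulr1.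
rewrite big1 ?addr0 ?subrr // => j jk.
by rewrite gz eq_sym (negbTE jk) mulr0.
Qed.

End FiniteRank.

(** Here [s] lists the terms of a tensor, and the arbitrary weights [G] stand for the values of a
    functional on the other legs. *)
Lemma seq_fin_rank (K : fieldType) (V W : lmodType K) (L : V -> W)
    (X : (V -> K) -> Prop) (T : Type) (s : seq T) (F : T -> V -> K) :
  (forall t, X (F t)) ->
  (forall v, (forall G : T -> K, \sum_(t <- s) F t v * G t = 0) -> L v = 0) ->
  fin_rank L X (size s).
Proof.
move=> XF kF; exists (fun k => F (tnth (in_tuple s) k)) => // v Fv.
by apply: kF => G; rewrite big_tnth big1 // => k _; rewrite Fv mul0r.
Qed.

(** A functional is extended from the line through [u - v]. Identities between vectors are thereby
    reduced to identities in the convolution algebra. *)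
Lemma cofun_ext (K : fieldType) (V : lmodType K) (u v : V) :
  (forall f, co_functional f -> f u = f v) -> u = v.
Proof.
move=> fuv; apply: contrapT => /eqP; rewrite -subr_eq0 => w0.
pose i (a : K^o) := a *: (u - v).
have li : co_linmap i by move=> a b c; rewrite /i scalerDl scalerA.
have [||f lf fi] := @linear_extension K K^o V K^o i id li; first by [].
  by move=> a /eqP; rewrite /i scaler_eq0 (negbTE w0) orbF => /eqP.
have := fi 1; rewrite /i scale1r (colinB lf) (fuv _ lf) subrr.
by move/esym/eqP; rewrite oner_eq0.
Qed.

(** * Convolution and its two actions on the coalgebra *)

Section Coalgebra.
Variables (K : fieldType) (C : coalgebra K).
Implicit Types (c d : C) (f g h : C -> K).

Let eps : C -> K := @counit K C.
Let leps : co_functional eps := counit_functional (c0 := C).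

Lemma conv_lin f g : co_functional f -> co_functional g ->
  co_functional (conv f g).
Proof. exact: comul_linear. Qed.

Lemma eq_convr f g g' : g =1 g' -> conv f g =1 conv f g'.
Proof. by move=> gg c; apply: eq_bigr => p _; rewrite gg. Qed.

Lemma convA f g h c : co_functional f -> co_functional g -> co_functional h ->
  conv (conv f g) h c = conv f (conv g h) c.
Proof. exact: comul_coassoc. Qed.

Lemma lactE f h c : co_functional f -> f (lact h c) = conv f h c.
Proof.
by move=> lf; rewrite (cofun_sum _ _ _ lf); apply: eq_bigr => p _; rewrite mulrC.
Qed.

Lemma ractE f h c : co_functional f -> f (ract c h) = conv h f c.
Proof. by move=> lf; rewrite (cofun_sum _ _ _ lf). Qed.

Lemma conv_counitl f c : co_functional f -> conv eps f c = f c.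
Proof.
by move=> lf; rewrite -{2}[c](counit_l c) (cofun_sum _ _ _ lf).
Qed.

Lemma conv_counitr f c : co_functional f -> conv f eps c = f c.
Proof. by move=> lf; rewrite -lactE // /lact counit_r. Qed.

Lemma lact_lin h : co_functional h -> co_linmap (lact h : C -> C).
Proof.
move=> lh a c d; apply: cofun_ext => f lf.
by rewrite lf !lactE // (conv_lin lf lh).
Qed.

Lemma ract_lin h : co_functional h -> co_linmap (fun c => ract c h).
Proof.
move=> lh a c d; apply: cofun_ext => f lf.
by rewrite lf !ractE // (conv_lin lh lf).
Qed.

Lemma lact_lact f g c : co_functional f -> co_functional g ->
  lact f (lact g c) = lact (conv f g) c.
Proof.
move=> lf lg; apply: cofun_ext => h lh.
by rewrite !lactE ?convA //; apply: conv_lin.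
Qed.

Lemma ract_ract f g c : co_functional f -> co_functional g ->
  ract (ract c f) g = ract c (conv f g).
Proof.
move=> lf lg; apply: cofun_ext => h lh.
by rewrite !ractE ?convA //; apply: conv_lin.
Qed.

Lemma ract_lact f g c : co_functional f -> co_functional g ->
  ract (lact g c) f = lact g (ract c f).
Proof.
move=> lf lg; apply: cofun_ext => h lh.
by rewrite ractE // !lactE ?ractE ?convA //; apply: conv_lin.
Qed.

(** * Right comodules, maps into the regular comodule, and subcomodules *)

Definition act (M : rcomod C) h (m : rcar M) : rcar M :=
  \sum_(p <- rcoact m) h p.2 *: p.1.

Lemma act_lin (M : rcomod C) h :
  co_functional h -> co_linmap (act h : rcar M -> rcar M).
Proof. exact: rc_linear. Qed.

Lemma act_act (M : rcomod C) f g (m : rcar M) :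
  co_functional f -> co_functional g -> act f (act g m) = act (conv f g) m.
Proof.
move=> lf lg; rewrite [RHS]/act -rc_coassoc // (colin_sum _ _ _ (act_lin lf)).
apply: eq_bigr => p _; rewrite scaler_sumr; apply: eq_bigr => q _.
by rewrite scalerA mulrC.
Qed.

Lemma regular_coassoc (f g : C -> K) c : co_functional f -> co_functional g ->
  \sum_(p <- comul c) \sum_(q <- comul p.1) (f q.2 * g p.2) *: q.1 =
  \sum_(p <- comul c) tpair (comul p.2) f g *: p.1.
Proof.
move=> lf lg; rewrite -[RHS]/(lact (conv f g) c) -lact_lact //.
rewrite {2}/lact (colin_sum _ _ _ (lact_lin lf)).
apply: eq_bigr => p _; rewrite scaler_sumr; apply: eq_bigr => q _.
by rewrite scalerA mulrC.
Qed.

Definition regular : rcomod C :=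
  @RComod K C C (@comul K C) lact_lin regular_coassoc (@counit_r K C).

(** The regular comodule is cofree on [K]: this is the comodule map whose composite with the counit
    is [xi]. *)
Definition cofree (M : rcomod C) (xi : rcar M -> K) (m : rcar M) : rcar regular :=
  \sum_(p <- rcoact m) xi p.1 *: p.2.

Lemma cofreeE (M : rcomod C) (xi : rcar M -> K) h m :
  co_functional xi -> co_functional h -> h (cofree xi m) = xi (act h m).
Proof.
move=> lxi lh; rewrite (cofun_sum _ _ _ lh) (cofun_sum _ _ _ lxi).
by apply: eq_bigr => p _; rewrite mulrC.
Qed.

Lemma cofree_hom (M : rcomod C) (xi : rcar M -> K) :
  co_functional xi -> rc_hom (cofree xi).
Proof.
move=> lxi; split=> [a m n|h m lh]; apply: cofun_ext => f lf.
  by rewrite lf !cofreeE // (act_lin lf) lxi.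
rewrite -[X in f (cofree _ X)]/(act h m) -[X in _ = f X]/(lact h (cofree xi m)).
by rewrite lactE // !cofreeE ?act_act //; apply: conv_lin.
Qed.

Lemma counit_cofree (M : rcomod C) (xi : rcar M -> K) m :
  co_functional xi -> eps (cofree xi m) = xi m.
Proof. by move=> lxi; rewrite cofreeE // /act rc_counit. Qed.

Lemma hom_act (M N : rcomod C) (k : rcar M -> rcar N) h m :
  rc_hom k -> co_functional h -> k (act h m) = act h (k m).
Proof. by move=> [_ hk] lh; apply: hk. Qed.

(* A comodule map to the regular comodule is determined by its composite with
   the counit. *)
Lemma ract_hom (M : rcomod C) (k k' : rcar M -> rcar regular) (b : C -> K) :
  rc_hom k -> rc_hom k' -> co_functional b ->
  (forall m, b (k m) = eps (k' m)) -> forall m, ract (k m) b = k' m.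
Proof.
move=> hk hk' lb bk m; apply: cofun_ext => f lf.
rewrite ractE // -lactE // -[lact _ _]/(act f (k m : rcar regular)) -hom_act //.
rewrite bk (hom_act _ hk') // -[act f _]/(lact f (k' m)) lactE //.
exact: conv_counitl.
Qed.

Lemma hom_lift (M N A : rcomod C) (j : rcar A -> rcar N) (g : rcar M -> rcar A) :
  rc_hom j -> injective j -> rc_hom (j \o g) -> rc_hom g.
Proof.
move=> [lj hj] ij [lg hg]; split=> [a u v|h m lh]; apply: ij.
  by rewrite lj; apply: lg.
by rewrite hj //; apply: hg.
Qed.

Lemma hom_comp (M N A : rcomod C) (j : rcar A -> rcar N) (g : rcar M -> rcar A) :
  rc_hom j -> rc_hom g -> rc_hom (j \o g).
Proof.
move=> [lj hj] [lg hg]; split=> [a u v|h m lh] /=; first by rewrite lg lj.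
by rewrite hg // hj.
Qed.

Lemma ract_is_hom b : co_functional b ->
  @rc_hom K C regular regular (fun c => ract c b).
Proof.
by move=> lb; split=> [|h c lh]; [exact: ract_lin | exact: ract_lact].
Qed.

Lemma subcomod (M : rcomod C) (P : rcar M -> Prop) :
  P 0 -> (forall (a : K) u v, P u -> P v -> P (a *: u + v)) ->
  (forall h m, co_functional h -> P m -> P (act h m)) ->
  exists (A : rcomod C) (j : rcar A -> rcar M),
    [/\ rc_hom j, injective j & forall m, P m <-> exists a, j a = m].
Proof.
move=> P0 PD PA; have [A [j [lj ij Pj]]] := subspace_lmod P0 PD.
(* [pi] is a linear retraction onto [A]. The single legs of a coaction need not lie in [P], but
   their pairing with any [h] does, so applying [pi] to the legs loses nothing. *)
have [//|u ju0|pi lpi pij] := @linear_extension K A (rcar M) A j id lj.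
  by apply: ij; rewrite ju0 colin0.
pose co a := [seq (pi p.1, p.2) | p <- rcoact (j a)].
have jco h a : co_functional h -> j (\sum_(p <- co a) h p.2 *: p.1) = act h (j a).
  move=> lh; have [a' ea'] : exists a', j a' = act h (j a).
    by apply/Pj/PA => //; apply/Pj; exists a.
  by rewrite big_map /= -(colin_sum _ _ _ lpi) -[X in pi X]/(act h (j a)) -ea' pij.
have co_lin h : co_functional h -> co_linmap (fun a => \sum_(p <- co a) h p.2 *: p.1).
  by move=> lh a u v; apply: ij; rewrite lj !jco // lj (act_lin lh).
have co_assoc f g a : co_functional f -> co_functional g ->
    \sum_(p <- co a) \sum_(q <- co p.1) (f q.2 * g p.2) *: q.1 =
    \sum_(p <- co a) tpair (comul p.2) f g *: p.1.
  move=> lf lg; apply: ij; rewrite (jco (conv f g)); last exact: conv_lin.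
  rewrite -act_act // -jco // -jco //; congr j.
  rewrite (colin_sum _ _ _ (co_lin _ lf)); apply: eq_bigr => p _.
  by rewrite scaler_sumr; apply: eq_bigr => q _; rewrite scalerA mulrC.
have co_counit a : \sum_(p <- co a) counit p.2 *: p.1 = a.
  by apply: ij; rewrite jco // /act rc_counit.
exists (RComod co_lin co_assoc co_counit), j; split=> //.
Qed.

Lemma simple_hom_inj (S N : rcomod C) (k : rcar S -> rcar N) (s0 : rcar S) :
  rc_simple S -> rc_hom k -> k s0 <> 0 -> injective k.
Proof.
move=> [_ simS] hk ks0; have lk := hk.1.
have [|a u v ku kv|h m lh km|A [j [hj ij Pj]]] :=
  @subcomod S (fun s => k s = 0).
- exact: colin0.
- by rewrite lk ku kv scaler0 addr0.
- by rewrite hom_act // km; apply: colin0; apply: act_lin.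
have [A0|Afull] := simS A j hj ij; last first.
  by case: ks0; apply/Pj/Afull.
apply: (colin_ker_inj lk) => s /Pj [a <-].
have [->|/eqP a0] := eqVneq a 0; first exact: (colin0 hj.1).
by case: A0; exists a.
Qed.

(** For a minimal family [u], the span of the [u k] is a right submodule containing [f]: the kernel
    of [c |-> ract c f] is stable under [lact h], so [conv (u k) h] vanishes on it and expands in
    the [u k]. The coefficients, read off at the dual vectors [z k], give the left coaction. *)
Lemma fin_rank_Rat_right f n : co_functional f ->
  fin_rank (fun c => ract c f) (@co_functional K C) n -> Rat_right_reg f.
Proof.
move=> lf /fin_rank_least [m [u lu ku] mmin].
have [//|Lu [z uz]] :=
  fin_rank_minimal (ract_lin lf) (fun _ l => l) (@cofun_comb K C) lu ku.
pose i (a : 'rV[K]_m) c := \sum_k a 0 k * u k c.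
have li a : co_functional (i a).
  move=> b c d; rewrite /i mulr_sumr -big_split; apply: eq_bigr => k _ /=.
  by rewrite lu mulrDr mulrCA.
have li2 c : co_functional (fun a => i a c).
  move=> b v w; rewrite /i mulr_sumr -big_split; apply: eq_bigr => k _ /=.
  by rewrite !mxE mulrDl mulrA.
have iz a k : i a (z k) = a 0 k.
  rewrite /i (bigD1 k) //= uz eqxx mulr1 big1 ?addr0 // => j jk.
  by rewrite uz (negbTE jk) mulr0.
have ii v w : i v =1 i w -> v = w.
  by move=> vw; apply/rowP => k; rewrite -!iz vw.
have iu k c : i (delta_mx 0 k) c = u k c.
  rewrite /i (bigD1 k) //= mxE !eqxx mul1r big1 ?addr0 // => j jk.
  by rewrite mxE (negbTE jk) andbF mul0r.
pose co a := [seq (ract (z k) (i a), delta_mx 0 k : 'rV[K]_m) | k <- index_enum 'I_m].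
have ico h a c : co_functional h ->
    i (\sum_(p <- co a) h p.1 *: p.2) c = conv (i a) h c.
  move=> lh; rewrite (cofun_sum _ _ _ (li2 c)) big_map.
  have lF := conv_lin (li a) lh.
  rewrite (@dual_expansion K C K^o (conv (i a) h) _ u z lF lu uz).
    by apply: eq_bigr => k _ /=; rewrite iu ractE // mulrC.
  move=> d ud; rewrite -lactE // /i big1 // => k _; rewrite Lu ?mulr0 //.
  by rewrite ract_lact // ku // (colin0 (lact_lin lh)).
have co_lin h : co_functional h ->
    co_linmap (fun a => \sum_(p <- co a) h p.1 *: p.2).
  move=> lh a v w; apply: ii => c.
  by rewrite li2 !ico // -!lactE // li2.
have co_assoc g h a : co_functional g -> co_functional h ->
    \sum_(p <- co a) tpair (comul p.1) g h *: p.2 =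
    \sum_(p <- co a) \sum_(q <- co p.2) (g p.1 * h q.1) *: q.2.
  move=> lg lh; apply: ii => c; rewrite (ico (conv g h)); last exact: conv_lin.
  rewrite -convA // -[conv (conv _ _) _ _]lactE; last exact: conv_lin.
  rewrite -ico // (cofun_sum _ _ _ (li2 _)).
  under [X in i X c]eq_bigr => p _.
    under eq_bigr => q _ do rewrite -scalerA.
    rewrite -scaler_sumr; over.
  rewrite (cofun_sum _ _ _ (li2 c)); apply: eq_bigr => p _.
  by rewrite ico // lactE.
have co_counit a : \sum_(p <- co a) counit p.1 *: p.2 = a.
  by apply: ii => c; rewrite ico // conv_counitr.
exists (LComod co_lin co_assoc co_counit), i; split=> //.
- by split=> // b v w c; rewrite li2.
- by move=> a h lh c; rewrite -ico // (cofun_sum _ _ _ (li2 c)).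
exists (\row_k f (z k)) => c.
rewrite (@dual_expansion K C K^o f _ u z lf lu uz).
  by apply: eq_bigr => k _; rewrite mxE mulrC.
move=> d ud; rewrite -(conv_counitr d lf) -ractE // ku //; exact: cofun0.
Qed.

End Coalgebra.

(** * The bilinear form attached to [phi], and the left rational part *)

Section RationalDual.
Variables (K : fieldType) (C : coalgebra K) (phi : C -> C -> K).
Hypotheses (lphi : dual_linmap phi) (iphi : dual_inj phi).
Hypothesis phi_ract :
  forall c h, dual_elt h -> phi (ract c h) =1 conv (phi c) h.

Definition psi (d c : C) : K := phi c d.

Lemma phi_lin c : co_functional (phi c).
Proof. exact: lphi.1. Qed.

Lemma psi_lin d : co_functional (psi d).
Proof. by move=> a u v; apply: lphi.2. Qed.

Lemma phi_eq0 c : (forall d, phi c d = 0) -> c = 0.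
Proof. by move=> c0; apply: iphi => d; rewrite c0 [RHS](cofun0 (psi_lin d)). Qed.

Lemma phi_balanced c d h : co_functional h -> phi (ract c h) d = phi c (lact h d).
Proof. by move=> lh; rewrite phi_ract // lactE //; apply: phi_lin. Qed.

Lemma conv_psi h d : co_functional h -> conv h (psi d) =1 psi (lact h d).
Proof.
move=> lh c; rewrite -ractE //; first exact: phi_balanced.
exact: psi_lin.
Qed.

Lemma ract_psi_fin_rank d :
  fin_rank (fun c => ract c (psi d)) (@co_functional K C) (size (comul d)).
Proof.
apply: (seq_fin_rank (F := fun p => psi p.2)) => [p|c kc]; first exact: psi_lin.
(* Balance is used twice: it moves [psi d] onto [x], then turns [conv (phi c) (psi d)] into
   [psi (lact (phi c) d)], where [c] enters only through the scalars [phi c p.2]. *)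
apply: phi_eq0 => x; rewrite phi_balanced; last exact: psi_lin.
rewrite lactE; last exact: phi_lin.
rewrite (conv_psi _ (phi_lin c)) /psi.
rewrite (cofun_sum _ _ _ (phi_lin x)); exact: kc.
Qed.

Lemma Rat_left_psi f : Rat_left_reg f -> exists d, psi d =1 f.
Proof.
case=> M [i [[li _] _ ci [m im]]].
have lf : co_functional f by move=> a u v; rewrite -!im; apply: li.
(* Taking the functionals from the image of [psi] makes the final expansion of [f] a combination of
   values of [psi]. *)
pose X (g : C -> K) := exists d, psi d =1 g.
have linX g : X g -> co_functional g.
  by case=> d dg a u v; rewrite -!dg; apply: psi_lin.
have XD (a : K) g h : X g -> X h -> X (fun c => a * g c + h c).
  case=> d dg [d' dh]; exists (a *: d + d') => c.
  by rewrite -dg -dh; apply: phi_lin.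
have : @fin_rank K C K^o f X (size (rcoact m)).
  apply: (seq_fin_rank (F := fun p => psi p.2)) => [p|c kc]; first by exists p.2.
  rewrite -(conv_counitr c lf) -ractE; last exact: counit_functional.
  (* Rationality, applied to the functional [phi c], expresses [phi (ract c f) x] through the
     scalars [phi c p.2], which are all zero. *)
  suff -> : ract c f = 0 by apply: (cofun0 (counit_functional (c0 := C))).
  apply: phi_eq0 => x; rewrite phi_ract // -(eq_convr _ im) ci; last exact: phi_lin.
  exact: kc.
case/fin_rank_least => n [g Xg kg] nmin.
have [_ [z gz]] := @fin_rank_minimal K C K^o f X lf linX XD n g Xg kg nmin.
have [d dg] := choice Xg.
exists (\sum_k f (z k) *: d k) => c.
have lg k := linX _ (Xg k).
rewrite (@dual_expansion K C K^o f n g z lf lg gz kg c).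
rewrite [LHS](cofun_sum _ _ _ (phi_lin c)); apply: eq_bigr => k _.
by rewrite -dg mulrC.
Qed.

(** Each [psi d] has finite rank, hence is right rational and equals some [phi c]. Thus a vector
    killed by every [phi c] is killed by every [psi d], and the nondegeneracy already known
    applies. *)
Lemma psi_inj : (forall f, Rat_right_reg f -> exists c, phi c =1 f) -> dual_inj psi.
Proof.
move=> surj u v uv; apply/eqP; rewrite -subr_eq0; apply/eqP.
apply: phi_eq0 => d.
have [c cd] := surj _ (fin_rank_Rat_right (psi_lin d) (ract_psi_fin_rank d)).
rewrite -[LHS]/(psi d (u - v)) -cd (cofunB (phi_lin c)).
by rewrite -[phi c u]/(psi u c) uv subrr.
Qed.

Lemma iso_Rat_left_psi : dual_inj psi -> iso_Rat_left C.
Proof.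
move=> ipsi.
have lpsi : dual_linmap psi.
  by split=> [u|a u v c]; [exact: psi_lin | exact: phi_lin].
have cpsi c h : co_functional h -> conv h (psi c) =1 psi (lact h c).
  exact: conv_psi.
exists psi; split=> // [c||c h lh d]; last by rewrite cpsi.
  (* [psi] itself presents its image as a rational submodule, with the regular coaction. *)
  exists (regular C), psi; split=> // [m h lh d|]; last by exists c.
  by rewrite cpsi // /psi (cofun_sum _ _ _ (phi_lin d)).
exact: Rat_left_psi.
Qed.

End RationalDual.

(** * Finite dimensional injective envelopes of simple comodules *)

Section Semiperfect.
Variables (K : fieldType) (C : coalgebra K).
Implicit Types (a b e : C -> K) (c : C).

Local Notation cofun := (@co_functional K C).
Local Notation rk a := (fin_rank (fun c : C => ract c a) cofun).

(** The action of [e] projects the regular comodule onto [E]. A map into [E] is determined by its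
    composite with the counit; that functional extends from [A] to [B], induces a map from [B] to
    the regular comodule, and is then projected. *)
Lemma retract_injective (E : rcomod C) (j : rcar E -> rcar (regular C)) e :
  rc_hom j -> injective j -> co_functional e ->
  (forall c, exists x, j x = ract c e) -> (forall x, ract (j x) e = j x) ->
  rc_injective E.
Proof.
move=> hj ij le /choice [q jq] je A B i f hi ii hf.
have hjf := hom_comp hj hf.
have leps := counit_functional (c0 := C).
have lxi : co_functional (fun x => counit (j (f x) : C)).
  by move=> k x y; rewrite [j _]hjf.1 leps.
have [x ix|beta lbeta ibeta] := @linear_extension K (rcar A) (rcar B) K^o i _ hi.1 lxi.
  have -> : x = 0 by apply: ii; rewrite ix (colin0 hi.1).
  exact: (cofun0 lxi).
have hG := cofree_hom lbeta.
have Gi x : cofree beta (i x) = j (f x).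
  have epsGi y : counit ((cofree beta \o i) y : C) = counit ((j \o f) y : C).
    by rewrite /= counit_cofree.
  by rewrite -[RHS](ract_hom (hom_comp hG hi) hjf leps epsGi) /ract counit_l.
have jg y : j (q (cofree beta y)) = ract (cofree beta y) e := jq _.
exists (q \o cofree beta); split=> [|x]; last by apply: ij; rewrite /= jq Gi.
apply: (hom_lift hj ij); have [lr hr] := hom_comp (ract_is_hom le) hG.
split=> [k x y|h x lh] /=; rewrite !jq; first exact: lr.
exact: hr.
Qed.

Lemma fin_rank_ract_conv a b n : cofun a -> cofun b ->
  rk a n -> rk (conv a b) n.
Proof.
move=> la lb [g lg kg]; exists g => // c gc.
by rewrite -ract_ract // kg // (colin0 (ract_lin lb)).
Qed.

(* The last clause comes from minimality: if it failed, [conv a b] would fix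
   [t] and have smaller rank than [a]. *)
Lemma minimal_fixer (T : Type) (t : T -> C) a0 n0 :
  cofun a0 -> (forall s, ract (t s) a0 = t s) -> rk a0 n0 ->
  exists a n (u : 'I_n -> C -> K) (z : 'I_n -> C),
    [/\ cofun a /\ (forall s, ract (t s) a = t s),
        (forall k, cofun (u k)) /\ (forall i k, u i (z k) = (i == k)%:R),
        forall c, (forall k, u k c = 0) <-> ract c a = 0
      & forall b c, cofun b -> (forall s, ract (t s) b = t s) ->
          ract (ract c a) b = 0 -> ract c a = 0].
Proof.
move=> la0 ta0 ra0.
pose Q n := exists a, [/\ cofun a, (forall s, ract (t s) a = t s) & rk a n].
have ex : exists n, `[< Q n >] by exists n0; apply/asboolP; exists a0.
case: (ex_minnP ex) => n /asboolP [a [la ta [u lu uL]]] nmin.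
have nQ m : (m < n)%N -> ~ Q m by move=> mn /asboolP /nmin; rewrite leqNgt mn.
have [|uk [z uz]] := fin_rank_minimal (ract_lin la) (fun _ l => l) (@cofun_comb K C) lu uL.
  by move=> m mn rm; apply: (nQ m mn); exists a.
exists a, n, u, z; split=> // [c|b c lb tb cab]; first by split; [apply: uL | apply: uk].
apply: (uL) => k.
apply/eqP/negP => /negP ukc.
case: n {nmin uk} u lu uL nQ z uz k ukc => [|n] u lu uL nQ z uz k ukc.
  by case: k ukc.
have lab := conv_lin la lb.
apply: (nQ n (ltnSn n)); exists (conv a b); split=> //.
  by move=> s; rewrite -ract_ract // ta tb.
apply: (fin_rank_drop (ract_lin lab) (fun _ l => l) (@cofun_comb K C) lu _ _ ukc).
  by move=> w uw; rewrite -ract_ract // uL // (colin0 (ract_lin lb)).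
by rewrite -ract_ract.
Qed.

(** In the coordinates [u], with the dual vectors [z] as basis, [M] is the matrix that [a] induces
    on the quotient by its kernel. Injectivity makes [M] invertible. *)
Lemma ract_image_stable a n (u : 'I_n -> C -> K) (z : 'I_n -> C) :
  cofun a -> (forall k, cofun (u k)) -> (forall i k, u i (z k) = (i == k)%:R) ->
  (forall c, (forall k, u k c = 0) <-> ract c a = 0) ->
  (forall c, ract (ract c a) a = 0 -> ract c a = 0) ->
  forall c, exists d, ract (ract d a) a = ract c a.
Proof.
move=> la lu uz kua inja c.
have ku d := (kua d).1; have uk d := (kua d).2.
have exp := dual_expansion (ract_lin la) lu uz ku.
pose comb (v : 'rV[K]_n) : C := \sum_k v 0 k *: z k.
pose M : 'M[K]_n := \matrix_(k, j) u j (ract (z k) a).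
have uM v j : u j (ract (comb v) a) = (v *m M) 0 j.
  rewrite [ract _ _](colin_sum _ _ _ (ract_lin la)) (cofun_sum _ _ _ (lu j)) mxE.
  by apply: eq_bigr => k _; rewrite mxE.
have ucomb v j : u j (comb v) = v 0 j.
  rewrite (cofun_sum _ _ _ (lu j)) (bigD1 j) //= uz eqxx mulr1 big1 ?addr0 //.
  by move=> i ij; rewrite uz eq_sym (negbTE ij) mulr0.
have Mu : M \in unitmx.
  rewrite -row_free_unit; apply: inj_row_free => v vM; apply/rowP => j.
  rewrite mxE -ucomb; apply: uk; apply: inja; apply: ku => k.
  by rewrite uM vM mxE.
(* This [d] solves [u k (ract d a) = u k c] for all [k]. *)
exists (comb (\row_k u k c *m invmx M)).
rewrite exp [RHS]exp; apply: eq_bigr => k _.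
by rewrite uM mulmxKV // mxE.
Qed.

Lemma fin_rank_semiperfect :
  (forall c, c <> 0 -> exists e n, [/\ cofun e, e c <> 0 & rk e n]) ->
  left_semiperfect C.
Proof.
move=> sep S simS; have [s0 s0N] := simS.1.
have leps := counit_functional (c0 := C).
have [xi lxi xis0] : exists2 xi : rcar S -> K, co_functional xi & xi s0 <> 0.
  apply: contrapT => nxi; apply: s0N; apply: cofun_ext => f lf.
  by rewrite (cofun0 lf); apply: contrapT => fs0; apply: nxi; exists f.
pose t := cofree xi; have ht : rc_hom t := cofree_hom lxi.
have epst s : counit (t s : C) = xi s by apply: counit_cofree.
have ts0 : t s0 <> 0 by move=> ts0; apply: xis0; rewrite -epst ts0 (cofun0 leps).
have [e [n0 [le ets0 re]]] := sep _ ts0.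
have it := simple_hom_inj simS ht ts0.
have hte := hom_comp (ract_is_hom le) ht.
(* The counit of [ract (t s0) e] is [e (t s0)], so the map is nonzero on the simple comodule [S]. *)
have ite : injective (fun s => ract (t s) e).
  apply: (simple_hom_inj simS hte (s0 := s0)) => /= te0; apply: ets0.
  by rewrite -(conv_counitr _ le) -ractE // te0 (cofun0 leps).
have lxi' : co_functional (fun s => counit (t s : C)).
  by move=> k x y; rewrite !epst lxi.
(* [b] undoes the action of [e] on the copy of [S], so [conv e b] fixes that copy and still has
   finite rank. *)
have [s es|b lb bte] := @linear_extension K (rcar S) C K^o _ _ hte.1 lxi'.
  have -> : s = 0 by apply: ite; rewrite [LHS]es [RHS](colin0 hte.1).
  exact: (cofun0 lxi').
have tb s : ract (t s) (conv e b) = t s.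
  by rewrite -ract_ract //; apply: (ract_hom hte ht).
have [a [n [u [z [[la ta] [lu uz] kua inja]]]]] :=
  minimal_fixer (conv_lin le lb) tb (fin_rank_ract_conv le lb re).
have inja2 c : ract (ract c a) a = 0 -> ract c a = 0 by exact: inja.
have stab := ract_image_stable la lu uz kua inja2.
have [|k x y [c ->] [d ->]|h x lh [c ->]|E [j [hj ij Pj]]] :=
  @subcomod K C (regular C) (fun x => exists c, x = ract c a).
- by exists 0; rewrite (colin0 (ract_lin la)).
- by exists (k *: c + d); rewrite [RHS](ract_lin la).
- by exists (lact h c); rewrite ract_lact.
have jE x : exists c, j x = ract c a by apply/Pj; exists x.
have Ej c : exists x, j x = ract c a by apply/Pj; exists c.
have hja := hom_comp (ract_is_hom la) hj.
have lepsj : co_functional (fun x => counit (j x : C)).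
  by move=> k x y; rewrite [j _]hj.1 leps.
(* Since [a] acts injectively on [E], some functional [b0] undoes its action there. *)
have [x|b0 lb0 b0a] := @linear_extension K (rcar E) C K^o _ _ hja.1 lepsj.
  by have [c /= ->] := jE x; move/inja2 => ->; exact: (cofun0 leps).
have ab0 x : ract (ract (j x) a) b0 = j x := ract_hom hja hj lb0 b0a x.
(* [conv b0 a] has its image in [E] and fixes [E]: by stability each element of [E] is [ract y a]
   with [y] in [E], and [b0] takes it back to [y]. *)
have injE : rc_injective E.
  apply: (retract_injective hj ij (conv_lin lb0 la)) => [c|x].
    by rewrite -ract_ract.
  have [c ->] := jE x; have [d <-] := stab c; have [y <-] := Ej d.
  by rewrite -ract_ract // ab0.
have [s|i ji] := @choice _ _ (fun s x => j x = t s).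
  by have [x jx] := Ej (t s); exists x; rewrite jx ta.
have hi : rc_hom i.
  by apply: (hom_lift hj ij); have -> : j \o i = t by exact: funext.
have ii : injective i by move=> s s' e1; apply: it; rewrite -!ji e1.
exists E, i; split; last first.
  (* The vectors [ract (z k) a] span [E]. *)
  have [x jx] := choice (fun k => Ej (z k)).
  exists n, x => v; have [c jv] := jE v; exists (fun k => u k c).
  apply: ij; rewrite (colin_sum _ _ _ hj.1) jv.
  rewrite (dual_expansion (ract_lin la) lu uz (fun d => (kua d).1) c).
  by apply: eq_bigr => k _; rewrite jx.
split=> // A f hf jf [x0 x0N]; apply: contrapT => ness.
have hjf := hom_comp hj hf.
(* If [S] and [A] meet trivially in [E], the functional equal to [xi] on [S] and to 0 on [A] is well
   defined on their sum. Its extension [b1] fixes [S] and annihilates [A]. *)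
pose sum_map (p : (rcar S * rcar A)%type) : C := t p.1 + j (f p.2).
have lsum : co_linmap sum_map.
  move=> k p q; rewrite /sum_map /= ht.1 [j _]hjf.1 scalerDr.
  by rewrite addrACA.
have lxi1 : co_functional (fun p : (rcar S * rcar A)%type => xi p.1).
  by move=> k p q; apply: lxi.
have [[s x] /= e1|b1 lb1 b1s] :=
    @linear_extension K (rcar S * rcar A)%type C K^o _ _ lsum lxi1.
  have [fx|fx] := eqVneq (f x) 0.
    move: e1; rewrite /sum_map /= fx (colin0 hj.1) addr0 => ts.
    by rewrite -epst ts (cofun0 leps).
  (* A nonzero [f x] would be a common element of the two images. *)
  case: ness; exists x, (- s); split; first exact/eqP.
  apply: ij; rewrite ji -[- s]add0r (colinB ht.1) (colin0 ht.1) sub0r.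
  by apply/eqP; rewrite -addr_eq0 addrC; apply/eqP.
have tb1 s : ract (t s) b1 = t s.
  apply: (ract_hom ht ht lb1) => s'; rewrite epst -(b1s (s', 0)) /sum_map /=.
  by rewrite [j _](colin0 hjf.1) addr0.
have zero_hom : @rc_hom K C A (regular C) (fun=> 0).
  split=> [k v w|h m lh]; first by rewrite scaler0 addr0.
  by rewrite [RHS](colin0 (act_lin lh)).
have fb1 x : ract (j (f x)) b1 = 0.
  apply: (ract_hom hjf zero_hom lb1) => y /=; rewrite (cofun0 leps).
  by rewrite -(cofun0 lxi) -(b1s (0, y)) /sum_map /= (colin0 ht.1) add0r.
apply: x0N; apply: jf; rewrite (colin0 hf.1); apply: ij; rewrite (colin0 hj.1).
have [c jc] := jE (f x0); rewrite jc; apply: (inja b1) => //.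
by rewrite -jc.
Qed.

End Semiperfect.

Theorem theorem2p6 (K : fieldType) (C : coalgebra K) :
  iso_Rat_right C -> left_semiperfect C /\ iso_Rat_left C.
Proof.
case=> phi [lphi iphi phiR Rphi phi_ract]; split.
  apply: fin_rank_semiperfect => c c0.
  have [d cd] : exists d, phi c d <> 0.
    apply: contrapT => nd; apply: c0; apply: (phi_eq0 lphi iphi) => d.
    by apply: contrapT => cd; apply: nd; exists d.
  exists (psi phi d), (size (comul d)); split=> //; first exact: psi_lin.
  exact: ract_psi_fin_rank.
apply: (iso_Rat_left_psi lphi iphi phi_ract); exact: psi_inj.
Qed.
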